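(* Let $f:\underline{X}\to\underline{Y}$ be a function, where $\underline{X}$ is a metrisable strongly zero-dimensional space, and suppose $\gamma=\operatorname{Lev}^2(f)$ exists and is a countable limit ordinal. Let $(\gamma_n)_{n\in\mathbb{N}}$ be a sequence of ordinals with $\gamma_n\leq\gamma$ for all $n$ and $\lim_{n\to\infty}\gamma_n=\gamma$ (i.e. for every $\alpha<\gamma$, $\gamma_n>\alpha$ for all sufficiently large $n$). Let $L_n=\mathcal{L}^2_{\gamma_n}(f)$ and let $f_n$ be the restriction of $f$ to $X\setminus L_n$. Then $f\equiv_2\lceil f_n\rceil_{n\in\mathbb{N}}$.
   Context: A topological space is strongly zero-dimensional metrisable if its topology is induced by a metric whose range is contained in $\{0\}\cup\{2^{-n}\mid n\in\mathbb{N}\}$. For $f:\underline{X}\to\underline{Y}$: $\mathcal{L}^2_0(f)=X$, $\mathcal{L}^2_{\alpha+1}(f)=cl\{x\in\mathcal{L}^2_\alpha(f)\mid f|_{\mathcal{L}^2_\alpha(f)}\text{ is discontinuous at }x\}$ (subspace topology, closure in $X$), $\mathcal{L}^2_\lambda(f)=cl\bigcap_{\alpha<\lambda}\mathcal{L}^2_\alpha(f)$ for limit $\lambda$; $\operatorname{Lev}^2(f)=\min\{\alpha\mid\mathcal{L}^2_\alpha(f)=\emptyset\}$. A partial function is continuous if continuous on its domain with the subspace topology. For functions $g:\underline{X}_1\to\underline{Y}_1$, $h:\underline{X}_2\to\underline{Y}_2$, $g\leq_2 h$ means there are continuous partial $F:\subseteq\underline{X}_1\times\underline{Y}_2\to\underline{Y}_1$,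 $G:\subseteq\underline{X}_1\to\underline{X}_2$ with $g(x)=F(x,h(G(x)))$ (all defined) for all $x\in X_1$; $g\equiv_2 h$ means $g\leq_2 h$ and $h\leq_2 g$. Each $f_n$ has domain $X\setminus L_n$ with the subspace topology; the coproduct $\coprod_n\underline{A}_n=\bigcup_n\{n\}\times A_n$ carries the smallest topology containing all $\{n\}\times U$, $U$ open in $\underline{A}_n$, and $\lceil f_n\rceil_{n\in\mathbb{N}}(n,x)=(n,f_n(x))$ maps $\coprod_n(X\setminus L_n)$ to $\coprod_n\underline{Y}$. *)

(* Defs.v *)
From HB Require Import structures.
From mathcomp Require Import all_boot all_order all_algebra.
From mathcomp Require Import all_classical all_reals topology.

Set Implicit Arguments.
Unset Strict Implicit.
Unset Printing Implicit Defensive.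

Import Order.TTheory GRing.Theory Num.Theory.

Local Open Scope classical_set_scope.
Local Open Scope ring_scope.

Definition is_metric (R : realType) (X : Type) (dist : X -> X -> R) : Prop :=
  [/\ forall x y, 0 <= dist x y,
      forall x y, dist x y = 0 <-> x = y,
      forall x y, dist x y = dist y x &
      forall x y z, dist x z <= dist x y + dist y z].

Definition induces_topology (R : realType) (X : topologicalType)
    (dist : X -> X -> R) : Prop :=
  forall U : set X, open U <->
    forall x, U x -> exists2 e : R, 0 < e & [set y | dist x y < e] `<=` U.

Definition strongly_zero_dim_metrisable (R : realType) (X : topologicalType)
    : Prop :=
  exists dist : X -> X -> R,
    [/\ is_metric dist, induces_topology dist &
        forall x y, dist x y = 0 \/ exists n : nat, dist x y = 2 ^- n].

(* An ordinal is represented as an element of a well-ordered type O, standing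
   for the order type of the initial segment below it; every ordinal g arises
   this way, e.g. as the top element of a copy of g + 1. All notions below
   depend only on initial segments of O. *)
Section Ordinals.
Context {d : Order.disp_t} {O : orderType d}.
Implicit Types a b : O.

Definition well_ordered : Prop := well_founded (fun a b => (a < b)%O).

Definition is_zero a : Prop := forall b, (a <= b)%O.

Definition is_succ b a : Prop :=
  (b < a)%O /\ forall c, (b < c)%O -> (a <= c)%O.

Definition is_limit a : Prop := ~ is_zero a /\ forall b, ~ is_succ b a.

End Ordinals.
Arguments well_ordered {d} O.

Section Level.
Context {d : Order.disp_t} {O : orderType d} (wfO : well_ordered O).
Context {X Y : topologicalType} (f : X -> Y).

(* A : set X used as a type is the subtype of its elements, which carries the
   subspace topology. *)
Definition restr (A : set X) : A -> Y := fun u => f (\val u).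

Definition discontinuities (A : set X) : set X :=
  [set \val u | u in [set u : A | ~ {for u, continuous (restr (A := A))}]].

(* The three disjuncts are mutually exclusive, cf. level2_zero, level2_succ
   and level2_limit below. *)
Definition level2_step (a : O) (L : forall b, (b < a)%O -> set X) : set X :=
  [set x | [\/ is_zero a,
      exists b (ba : (b < a)%O),
        is_succ b a /\ closure (discontinuities (L b ba)) x |
      is_limit a /\
        closure [set z | forall b (ba : (b < a)%O), L b ba z] x]].

Definition level2 : O -> set X := Fix wfO (fun=> set X) level2_step.

Lemma level2E a : level2 a = level2_step (fun b (_ : (b < a)%O) => level2 b).
Proof.
rewrite /level2 Fix_eq// => b L L' LL'; congr level2_step.
by apply: functional_extensionality_dep => c; apply/funext => cb; exact: LL'.
Qed.

Lemma level2_zero a : is_zero a -> level2 a = setT.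
Proof. by move=> a0; rewrite level2E -subTset => x _; exact: Or31. Qed.

Lemma is_succ_nonzero (a b : O) : is_succ b a -> ~ is_zero a.
Proof. by move=> [ba _] /(_ b); rewrite leNgt ba. Qed.

Lemma is_succ_inj (a b c : O) : is_succ b a -> is_succ c a -> b = c.
Proof.
move=> [ba bmin] [ca cmin]; case: (ltgtP b c) => //.
- by move/bmin; rewrite leNgt ca.
- by move/cmin; rewrite leNgt ba.
Qed.

Lemma level2_succ a b : is_succ b a ->
  level2 a = closure (discontinuities (level2 b)).
Proof.
move=> ba; rewrite level2E; apply/seteqP; split => x.
- case=> [a0|[c [ca [sca]]]|[[_ /(_ b)]//]].
  + by have := is_succ_nonzero ba a0.
  + by rewrite (is_succ_inj ba sca).
- by move=> bx; apply: Or32; exists b, (proj1 ba).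
Qed.

Lemma level2_limit a : is_limit a ->
  level2 a = closure (\bigcap_(b in [set b | (b < a)%O]) level2 b).
Proof.
move=> la; rewrite level2E; apply/seteqP; split => x.
- by case=> [a0|[c [ca [sca]]]|[]//]; [case: la | case: la => _ /(_ c)].
- by move=> ax; apply: Or33; split.
Qed.

Definition is_Lev2 (a : O) : Prop :=
  level2 a = set0 /\ forall b, level2 b = set0 -> (a <= b)%O.

End Level.

(* F and G are partial functions, defined on the subspaces DF and DG. *)
Definition le2 {X1 Y1 X2 Y2 : topologicalType} (g : X1 -> Y1) (h : X2 -> Y2)
    : Prop :=
  exists (DF : set (X1 * Y2)) (F : DF -> Y1) (DG : set X1) (G : DG -> X2),
    [/\ continuous F, continuous G &
        forall x : X1, exists (u : DG) (v : DF),
          [/\ \val u = x, \val v = (x, h (G u)) & g x = F v]].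

Definition equiv2 {X1 Y1 X2 Y2 : topologicalType}
    (g : X1 -> Y1) (h : X2 -> Y2) : Prop :=
  le2 g h /\ le2 h g.

(* The library topology on {n & A n} is the coproduct topology. *)
Definition coprod_fun {A B : nat -> topologicalType}
    (g : forall n, A n -> B n) : {n : nat & A n} -> {n : nat & B n} :=
  fun u => existT _ (projT1 u) (g (projT1 u) (projT2 u)).

(* Main.v *)
Require Import Defs.
From HB Require Import structures.
From mathcomp Require Import all_boot all_order all_algebra.
From mathcomp Require Import all_classical all_reals topology sequences.
From mathcomp Require Import lra.

Import Order.TTheory GRing.Theory Num.Theory.

Local Open Scope classical_set_scope.
Local Open Scope ring_scope.

(** The complements of the levels [L_n] are open and, since the level at the
  limit [gamma] is empty, they cover [X].  The reduction of [f] to the coproduct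
  has to choose, locally constantly in [x], an index [n] with [x] outside [L_n];
  the converse reduction forgets this index and then restores it.  A dyadic
  distance below [2 * 2^-k] is at most [2^-k], so points at distance at most
  [2^-(k+1)] have the same closed ball of radius [2^-k].  Hence the points whose
  closed ball of radius [2^-k] lies in an open set [U] form a clopen set, and
  [U] is the union of these over [k].  The open cover thus refines to a
  countable clopen cover, which becomes a partition after removing from each
  member the earlier ones. *)

Definition locally_constant {X : topologicalType} {T : Type} (g : X -> T) :=
  forall x, \forall y \near x, g y = g x.

Definition locally_constant_selection {X : topologicalType} {I : Type}
    (D : I -> set X) :=
  exists2 s : X -> I, locally_constant s & forall x, D (s x) x.

Section LocallyConstant.
Context {X : topologicalType} {T : Type} {g : X -> T}.
Hypothesis g_cst : locally_constant g.

Lemma locally_constant_comp {T' : Type} (h : T -> T') :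
  locally_constant (h \o g).
Proof. by move=> x; apply: filterS (g_cst x) => y /= ->. Qed.

Lemma open_preimage_locally_constant (D : set T) : open (g @^-1` D).
Proof.
rewrite openE => x Dgx; apply: filterS (g_cst x) => y gyx.
by rewrite /preimage/= gyx.
Qed.

Lemma clopen_preimage_locally_constant (D : set T) : clopen (g @^-1` D).
Proof.
split; first exact: open_preimage_locally_constant.
by rewrite -openC preimage_setC; exact: open_preimage_locally_constant.
Qed.

End LocallyConstant.

Lemma locally_constant_comp_continuous {Z X : topologicalType} {T : Type}
    {g : X -> T} {h : Z -> X} :
  locally_constant g -> continuous h -> locally_constant (g \o h).
Proof. by move=> g_cst ch z; exact: (ch z _ (g_cst (h z))). Qed.

Definition countable_clopen_union {X : topologicalType} (U : set X) :=
  exists2 C : nat -> set X, forall k, clopen (C k) & U = \bigcup_k C k.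

Section LocallyConstantSelection.
Context {X : topologicalType}.

Lemma open_partition_selection {I : Type} (D : I -> set X) :
  (forall i, open (D i)) -> trivIset setT D -> \bigcup_i D i = setT ->
  locally_constant_selection D.
Proof.
move=> oD tD covD.
have ex_index x : exists i, D i x.
  have [i _ Dix] : (\bigcup_i D i) x by rewrite covD.
  by exists i.
have [s Ds] := choice ex_index; exists s => // x.
have nD : nbhs x (D (s x)) by exact: open_nbhs_nbhs.
by apply: filterS nD => y Dy; apply: tD => //; exists y.
Qed.

Lemma clopen_cover_selection (C : nat -> set X) :
  (forall n, clopen (C n)) -> \bigcup_n C n = setT ->
  locally_constant_selection C.
Proof.
move=> clC covC.
have [n|||s s_cst Cs] := open_partition_selection (seqDU C).
- apply: openI; first by case: (clC n).
  by apply/closed_openC/closed_bigsetU => m _; case: (clC m).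
- exact: trivIset_seqDU.
- by rewrite -seqDU_bigcup_eq.
by exists s => // x; case: (Cs x).
Qed.

Lemma countable_clopen_union_selection (U : nat -> set X) :
  (forall n, countable_clopen_union (U n)) -> \bigcup_n U n = setT ->
  locally_constant_selection U.
Proof.
move=> unionU covU.
have ex_clopens n : exists C : nat -> set X,
    (forall k, clopen (C k)) /\ U n = \bigcup_k C k.
  by have [C] := unionU n; exists C.
have [C clC] := choice ex_clopens.
pose decode m : nat * nat := odflt (0, 0)%N (unpickle m).
have [m||s s_cst Cs] :=
    clopen_cover_selection (fun m => C (decode m).1 (decode m).2).
- exact: (proj1 (clC _)).
- rewrite -subTset -covU => x [n _]; rewrite (proj2 (clC n)) => -[k _ Cx].
  by exists (pickle (n, k)) => //; rewrite /decode pickleK.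
exists (fst \o decode \o s) => [|x /=]; first exact: locally_constant_comp.
by rewrite (proj2 (clC _)); exists (decode (s x)).2.
Qed.

End LocallyConstantSelection.

Section DyadicMetric.
Context {R : realType} {X : topologicalType} {dist : X -> X -> R}.
Hypothesis dist_metric : is_metric dist.
Hypothesis dist_top : induces_topology dist.
Hypothesis dist_dyadic :
  forall x y, dist x y = 0 \/ exists n : nat, dist x y = 2 ^- n.

Definition dyadic_ball k x : set X := [set y | dist x y <= 2 ^- k].

Let distxx x : dist x x = 0.
Proof. by case: dist_metric => _ d0 _ _; apply/d0. Qed.

Let distC x y : dist x y = dist y x.
Proof. by case: dist_metric. Qed.

Let dist_triangle y x z : dist x z <= dist x y + dist y z.
Proof. by case: dist_metric. Qed.

Let invX2_gt0 k : 0 < 2 ^- k :> R.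
Proof. by rewrite invr_gt0 exprn_gt0. Qed.

Let invX2S k : 2 ^- k = 2 * 2 ^- k.+1 :> R.
Proof. by rewrite exprS invfM mulrA divff ?mul1r ?pnatr_eq0. Qed.

Lemma dyadic_ball_center k x : dyadic_ball k x x.
Proof. by rewrite /dyadic_ball/= distxx ltW. Qed.

Lemma dist_dyadic_gap k x y : dist x y < 2 * 2 ^- k -> dist x y <= 2 ^- k.
Proof.
case: (dist_dyadic x y) => [->|[n ->]]; first by rewrite ltW.
rewrite [ltLHS]invX2S ltr_pM2l// ltf_pV2 ?posrE ?exprn_gt0// ltr_eXn2l ?ltr1n//.
by rewrite ltnS lef_pV2 ?posrE ?exprn_gt0// ler_eXn2l ?ltr1n.
Qed.

Lemma dyadic_ball_subset k x y :
  dist x y <= 2 ^- k.+1 -> dyadic_ball k x `<=` dyadic_ball k y.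
Proof.
move=> xy z xz; apply: dist_dyadic_gap; move: xz; rewrite /dyadic_ball/= => xz.
have := dist_triangle x y z; have := invX2_gt0 k; have := invX2S k.
by rewrite (distC y x); lra.
Qed.

Lemma dyadic_ball_eq k x y :
  dist x y <= 2 ^- k.+1 -> dyadic_ball k x = dyadic_ball k y.
Proof.
by move=> xy; apply/seteqP; split; apply: dyadic_ball_subset; rewrite // distC.
Qed.

Lemma near_dist_lt e x : 0 < e -> \forall y \near x, dist x y < e.
Proof.
move=> e0; apply: open_nbhs_nbhs; split; last by rewrite /= distxx.
apply/dist_top => y /= xy; exists (e - dist x y); first by rewrite subr_gt0.
by move=> z /=; have := dist_triangle y x z; lra.
Qed.

Lemma dyadic_ball_locally_constant k : locally_constant (dyadic_ball k).
Proof.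
move=> x; apply: filterS (near_dist_lt _ x (invX2_gt0 k.+1)) => y /ltW xy.
by rewrite (dyadic_ball_eq _ _ _ xy).
Qed.

Lemma open_dyadic_ballP (U : set X) x :
  open U -> U x <-> exists k, dyadic_ball k x `<=` U.
Proof.
move=> /dist_top oU; split=> [/oU[e e0 eU]|[k]]; last first.
  by apply; exact: dyadic_ball_center.
exists (Num.bound e^-1) => y xy; apply: eU; apply: (le_lt_trans xy).
by rewrite invf_plt ?posrE ?exprn_gt0// upper_nthrootP.
Qed.

Lemma open_countable_clopen_union (U : set X) :
  open U -> countable_clopen_union U.
Proof.
move=> oU; exists (fun k => dyadic_ball k @^-1` [set B | B `<=` U]) => [k|].
  exact/clopen_preimage_locally_constant/dyadic_ball_locally_constant.
apply/seteqP; split=> x.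
- by move=> /(open_dyadic_ballP _ _ oU)[k kU]; exists k.
- by move=> [k _ kU]; apply/(open_dyadic_ballP _ _ oU); exists k.
Qed.

End DyadicMetric.

Lemma strongly_zero_dim_open_cover_selection
    {R : realType} {X : topologicalType} (U : nat -> set X) :
  strongly_zero_dim_metrisable R X ->
  (forall n, open (U n)) -> \bigcup_n U n = setT ->
  locally_constant_selection U.
Proof.
move=> [dist [dist_metric dist_top dist_dyadic]] oU.
apply: countable_clopen_union_selection => n.
exact: (open_countable_clopen_union dist_metric dist_top dist_dyadic).
Qed.

Section Levels.
Context {d : Order.disp_t} {O : orderType d} (wfO : well_ordered O).
Context {X Y : topologicalType} (f : X -> Y).

Lemma zero_succ_limit_cases (a : O) :
  [\/ is_zero a, exists b, is_succ b a | is_limit a].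
Proof.
have [a0|a0] := pselect (is_zero a); first exact: Or31.
have [sa|sa] := pselect (exists b, is_succ b a); first exact: Or32.
by apply: Or33; split=> // b ba; apply: sa; exists b.
Qed.

Lemma closed_level2 a : closed (level2 wfO f a).
Proof.
case: (zero_succ_limit_cases a) => [a0|[b ba]|la].
- by rewrite level2_zero//; exact: closedT.
- by rewrite (level2_succ wfO f ba); exact: closed_closure.
- by rewrite level2_limit//; exact: closed_closure.
Qed.

Lemma level2_limit_bigcap a : is_limit a ->
  level2 wfO f a = \bigcap_(b in [set b | (b < a)%O]) level2 wfO f b.
Proof.
move=> la; rewrite level2_limit// -(proj1 (closure_id _))//.
by apply: closed_bigI => b _; exact: closed_level2.
Qed.

Lemma level2_succ_subset a b :
  is_succ b a -> level2 wfO f a `<=` level2 wfO f b.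
Proof.
move=> ba; rewrite (level2_succ wfO f ba).
apply: subset_trans (closed_level2 b).
by apply: closureS => _ [u _ <-]; exact: set_valP.
Qed.

Lemma level2_anti a b : (b <= a)%O -> level2 wfO f a `<=` level2 wfO f b.
Proof.
elim/(well_founded_ind wfO): a => a IHa; rewrite le_eqVlt => /predU1P[->//|ba].
case: (zero_succ_limit_cases a) => [/(_ b)|[c ca]|la].
- by rewrite leNgt ba.
- have bc : (b <= c)%O.
    by rewrite leNgt; apply/negP => /(proj2 ca); rewrite leNgt ba.
  exact: subset_trans (level2_succ_subset _ _ ca) (IHa c (proj1 ca) bc).
- by rewrite level2_limit_bigcap// => x; apply.
Qed.

Lemma level2_limit_cofinal_subset (I : Type) a (a_ : I -> O) : is_limit a ->
  (forall b, (b < a)%O -> exists i, (b < a_ i)%O) ->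
  \bigcap_i level2 wfO f (a_ i) `<=` level2 wfO f a.
Proof.
move=> la cof x Lx; rewrite level2_limit_bigcap// => b /cof[i bi].
by apply: (level2_anti _ _ (ltW bi)); exact: Lx.
Qed.

End Levels.

Section ContinuousCoproduct.
Context {I : choiceType} {Z X Y : topologicalType}.

Lemma locally_constant_projT1 {A : I -> topologicalType} :
  locally_constant (@projT1 I A).
Proof. by case=> n x; apply: existT_continuous; exact: nearW. Qed.

Lemma continuous_existT_locally_constant (s : Z -> I) (g : Z -> Y) :
  locally_constant s -> continuous g ->
  continuous (fun z => existT (fun=> Y) (s z) (g z)).
Proof.
move=> s_cst cg z W /= /cg gW.
by apply: filterS2 (s_cst z) gW => w /= ->.
Qed.

Lemma continuous_coprod_subspace (A : I -> set X)
    (g : Z -> {n : I & (A n : topologicalType)}) :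
  locally_constant (@projT1 _ _ \o g) ->
  continuous (fun z => \val (projT2 (g z))) -> continuous g.
Proof.
move=> s_cst cg z W [_ [[V oV <-] Vgz] VW].
have nV : nbhs z ((fun w => \val (projT2 (g w))) @^-1` V).
  by apply: cg; exact: open_nbhs_nbhs.
apply: filterS2 (s_cst z) nV => w /=; move: VW {Vgz}.
case: (g z) (g w) => [n x] [m y] /= + mn; case: n / mn x => x; exact.
Qed.

End ContinuousCoproduct.

Lemma le2_total {X1 Y1 X2 Y2 : topologicalType} (g : X1 -> Y1) (h : X2 -> Y2)
    (F : X1 * Y2 -> Y1) (G : X1 -> X2) :
  continuous F -> continuous G -> (forall x, g x = F (x, h (G x))) -> le2 g h.
Proof.
move=> cF cG gE.
have cval (T : topologicalType) : continuous (\val : [set: T] -> T).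
  exact: initial_continuous.
exists setT, (F \o \val), setT, (G \o \val); split.
- by move=> u; apply: continuous_comp; [exact: cval|exact: cF].
- by move=> u; apply: continuous_comp; [exact: cval|exact: cG].
move=> x.
have xT : x \in [set: X1] by rewrite inE.
have yT : (x, h (G x)) \in [set: X1 * Y2] by rewrite inE.
by exists (SigSub xT), (SigSub yT).
Qed.

Section RestrictionCoproduct.
Context {X Y : topologicalType} (f : X -> Y) (A : nat -> set X).

Let coprodA : topologicalType := {n : nat & (A n : topologicalType)}.

Let coprod_restr : coprodA -> {n : nat & Y} :=
  coprod_fun (B := fun=> Y) (fun n => restr f (A := A n)).

Lemma coprod_restr_le2 : le2 coprod_restr f.
Proof.
pose restore (v : coprodA * Y) := existT (fun=> Y) (projT1 v.1) v.2.
pose forget (u : coprodA) := \val (projT2 u).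
apply: (le2_total _ _ restore forget) => //.
- apply: continuous_existT_locally_constant; last by move=> v; exact: cvg_snd.
  apply: (locally_constant_comp_continuous locally_constant_projT1) => v.
  exact: cvg_fst.
- apply: (sigT_continuous (fun n => \val : A n -> X)) => n.
  exact: initial_continuous.
Qed.

Lemma le2_coprod_restr :
  locally_constant_selection A -> le2 f coprod_restr.
Proof.
move=> [s s_cst As].
pose inject x : coprodA := existT _ (s x) (SigSub (mem_set (As x))).
pose forget (v : X * {n : nat & Y}) := projT2 v.2.
apply: (le2_total _ _ forget inject) => //.
- move=> v; apply: continuous_comp; first exact: cvg_snd.
  by apply: (sigT_continuous (fun=> @idfun Y)) => n y.
- by apply: continuous_coprod_subspace => // x; exact: cvg_id.
Qed.

End RestrictionCoproduct.

Theorem theorem6p3 (R : realType) (d : Order.disp_t) (O : orderType d)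
    (wfO : well_ordered O) (X Y : topologicalType) (f : X -> Y)
    (gamma : O) (gamma_ : nat -> O) :
  strongly_zero_dim_metrisable R X ->
  is_Lev2 wfO f gamma ->
  is_limit gamma ->
  countable [set a : O | (a < gamma)%O] ->
  (forall n : nat, (gamma_ n <= gamma)%O) ->
  (forall a : O, (a < gamma)%O ->
    exists N : nat, forall n : nat, (N <= n)%N -> (a < gamma_ n)%O) ->
  equiv2 f
    (coprod_fun (A := fun n => (~` level2 wfO f (gamma_ n) : set X))
                (B := fun=> Y)
                (fun n => restr f (A := ~` level2 wfO f (gamma_ n)))).
Proof.
move=> szX [L0 _] lim_gamma _ _ gamma_lim.
have open_compl n : open (~` level2 wfO f (gamma_ n)).
  exact/closed_openC/closed_level2.
have empty_inter : \bigcap_n level2 wfO f (gamma_ n) = set0.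
  rewrite -subset0 -L0; apply: level2_limit_cofinal_subset => // a.
  by move=> /gamma_lim[N aN]; exists N; exact: aN.
have cover : \bigcup_n ~` level2 wfO f (gamma_ n) = setT.
  by rewrite -setC_bigcap empty_inter setC0.
split; last exact: coprod_restr_le2.
exact/le2_coprod_restr/(strongly_zero_dim_open_cover_selection _ szX).
Qed.
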